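(* Let $K\subseteq\mathbb R$ be compact. If $|||\cdot|||_n$ is a dominating norm on $C^\infty(K)$, then the following holds: for every $m\in\mathbb N$ there is $r\ge1$ such that for every $k\in\mathbb N$ there is $c_k>0$ such that for all polynomials $P$ of degree $\le k$, all $\varepsilon>0$, all accumulation points $y$ of $K$, and all $f\in C^\infty(\mathbb R)$ with $\operatorname{supp}(f)\subseteq(y-\varepsilon,y+\varepsilon)$ and $f=\varphi_{\varepsilon,y}P$ on $K$ we have $$|P^{(m)}(y)|^2\le\frac{c_k}{\varepsilon^r}\,\sup_{|t-y|<\varepsilon}|P(t)|\,\sup_{|t-y|<\varepsilon,\ j\le n}|f^{(j)}(t)|.$$
   Context: Fix a smooth compactly supported function $\varphi$ on $\mathbb R$ with $\operatorname{supp}(\varphi)\subseteq[-1,1]$ and $\varphi=1$ on $[-1/2,1/2]$, and write $\varphi_{\varepsilon,y}(x)=\varphi\bigl(\frac{x-y}{\varepsilon}\bigr)$ for $y\in\mathbb R$, $\varepsilon>0$. For compact $K\subseteq\mathbb R$ let $C^\infty(K)=\{F|_K: F\in C^\infty(\mathbb R)\}$ with the norms $|||h|||_n=\inf\{\|F\|_n: F\in C^\infty(\mathbb R),\ F|_K=h\}$, where $\|F\|_n=\sup\{|F^{(j)}(x)|:x\in\mathbb R,\ 0\le j\le n\}\in[0,\infty]$. The norm $|||\cdot|||_n$ is dominating on $C^\infty(K)$ if for every $m\ge n$ there are $k\ge m$ and $c>0$ such that $|||h|||_m^2\le c\,|||h|||_k\,|||h|||_n$ for all $h\in C^\infty(K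)$.
   Formalization: The factor 1/ε^r is replaced by 1/min(ε,1)^r: the printed bound is kept for ε ≤ 1, while for ε > 1 only the bound without ε^{-r} is claimed, because the printed inequality fails as ε → ∞ (e.g. K=[0,1], m=0, P=1, f a fixed cutoff equal to 1 on K). *)

(* Defs.v *)
From HB Require Import structures.
From mathcomp Require Import all_boot all_order all_algebra.
From mathcomp Require Import all_classical all_reals all_analysis.

Set Implicit Arguments.
Unset Strict Implicit.
Unset Printing Implicit Defensive.

Import Order.TTheory GRing.Theory Num.Theory.
Import numFieldNormedType.Exports.

Local Open Scope classical_set_scope.
Local Open Scope ring_scope.

Definition smooth (R : realType) (f : R -> R) : Prop :=
  forall (j : nat) (x : R), derivable (derive1n j f) x 1.

Definition supp (R : realType) (f : R -> R) : set R :=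
  closure [set x | f x != 0].

Definition dilate (R : realType) (phi : R -> R) (e y : R) : R -> R :=
  fun x => phi ((x - y) / e).

Definition sup_abs (R : realType) (A : set R) (g : R -> R) : \bar R :=
  ereal_sup [set (`|g t|)%:E | t in A].

Definition sup_derivs (R : realType) (n : nat) (A : set R) (f : R -> R) :
    \bar R :=
  ereal_sup [set (`|derive1n j f x|)%:E | j in [set j | (j <= n)%N] & x in A].

Definition Cnorm (R : realType) (n : nat) (F : R -> R) : \bar R :=
  sup_derivs n [set: R] F.

(* A function on K is represented by its extension by a fixed constant outside
   K (the library's restriction [F \_ K]), so that two smooth functions yield
   the same element exactly when they agree on K. *)
Definition Cinfty_on (R : realType) (K : set R) : set (R -> R) :=
  [set F \_ K | F in @smooth R].

Definition quotient_norm (R : realType) (K : set R) (n : nat) (h : R -> R) :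
    \bar R :=
  ereal_inf [set Cnorm n F | F in [set F | smooth F /\ F \_ K = h]].

Definition dominating_norm (R : realType) (K : set R) (n : nat) : Prop :=
  forall m : nat, (n <= m)%N ->
  exists (k : nat) (c : R), [/\ (m <= k)%N, 0 < c &
    forall h : R -> R, Cinfty_on K h ->
      (quotient_norm K m h * quotient_norm K m h <=
       c%:E * quotient_norm K k h * quotient_norm K n h)%E].

(* Main.v *)
(* At an accumulation point [y] of [K] all derivatives of a smooth function are
   determined by its values on [K] (Rolle), so [|P^(m)(y)|] is at most the
   quotient norm of order [max m n] of [f|_K].  The domination inequality then
   splits its square into a factor of order [n], bounded by [f] itself, and one
   of some order [N], bounded by the extension [phi_{e,y} P].  Rescaling to
   [e = 1] the latter costs [min(e,1)^-N]; the remaining constant is uniform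
   because the coefficients of a polynomial of degree at most [k] are controlled
   by its supremum on [(-1,1)]. *)
Require Import Defs.
From HB Require Import structures.
From mathcomp Require Import all_boot all_order all_algebra.
From mathcomp Require Import all_classical all_reals all_analysis.

Import Order.TTheory GRing.Theory Num.Theory.
Import numFieldNormedType.Exports.

Local Open Scope classical_set_scope.
Local Open Scope ring_scope.

(** * Smooth functions: sums, products, polynomials *)

Lemma smooth_derive1 (R : realType) (f : R -> R) : smooth f -> smooth (derive1 f).
Proof. by move=> sf j x; rewrite -derive1Sn; exact: sf. Qed.

Lemma smooth_derivable (R : realType) (f : R -> R) (x : R) :
  smooth f -> derivable f x 1.
Proof. by move=> sf; exact: (sf 0%N x). Qed.

Lemma smooth_continuous (R : realType) (f : R -> R) : smooth f -> continuous f.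
Proof.
by move=> sf x; apply/differentiable_continuous/derivable1_diffP/smooth_derivable.
Qed.

Lemma smooth_derive1n (R : realType) (f : R -> R) j :
  smooth f -> smooth (derive1n j f).
Proof. by elim: j => // j IH /IH; rewrite derive1nS => /smooth_derive1. Qed.

(** Derivability is assumed only below order [j], so that the rule already applies inside the
    induction proving that products are smooth. *)
Lemma derive1nD (R : realType) (f g : R -> R) (j : nat) :
  (forall i x, (i < j)%N -> derivable (derive1n i f) x 1) ->
  (forall i x, (i < j)%N -> derivable (derive1n i g) x 1) ->
  derive1n j (fun x => f x + g x) = fun x => derive1n j f x + derive1n j g x.
Proof.
elim: j => // j IH df dg; rewrite !derive1nS IH => [|i x ij|i x ij].
- apply/funext => x.
  by rewrite !derive1E (@deriveD _ _ _ (derive1n j f) (derive1n j g)) //;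
    [exact: df|exact: dg].
- exact/df/ltnW.
- exact/dg/ltnW.
Qed.

Lemma smoothD (R : realType) (f g : R -> R) :
  smooth f -> smooth g -> smooth (fun x => f x + g x).
Proof.
move=> sf sg j x; rewrite derive1nD => [|i z _|i z _]; [|exact: sf|exact: sg].
exact: (@derivableD _ _ _ (derive1n j f) (derive1n j g)).
Qed.

Lemma derive1nZ (R : realType) (a : R) (f : R -> R) (j : nat) :
  smooth f -> derive1n j (fun x => a * f x) = fun x => a * derive1n j f x.
Proof.
move=> sf; elim: j => // j IH; rewrite !derive1nS IH; apply/funext => x.
by rewrite derive1Ml.
Qed.

Lemma smoothZ (R : realType) (a : R) (f : R -> R) :
  smooth f -> smooth (fun x => a * f x).
Proof.
move=> sf j x; rewrite derive1nZ //.
exact: (@derivableZ _ _ _ (derive1n j f) a).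
Qed.

Lemma smooth_sum (R : realType) (k : nat) (f : nat -> R -> R) :
  (forall i, smooth (f i)) -> smooth (fun x => \sum_(i < k) f i x).
Proof.
move=> sf; elim: k => [|k IH].
  (* The empty sum is the zero function, presented as a multiple of [f 0] so that [smoothZ] covers
     it. *)
  rewrite (_ : (fun _ => _) = fun x => 0 * f 0%N x); first exact: smoothZ.
  by apply/funext => x; rewrite big_ord0 mul0r.
rewrite (_ : (fun _ => _) = fun x => \sum_(i < k) f i x + f k x).
  exact: smoothD.
by apply/funext => x; rewrite big_ord_recr.
Qed.

Lemma derive1n_sum (R : realType) (k : nat) (f : nat -> R -> R) (j : nat) :
  (forall i, smooth (f i)) ->
  derive1n j (fun x => \sum_(i < k) f i x) =
  fun x => \sum_(i < k) derive1n j (f i) x.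
Proof.
move=> sf; elim: k => [|k IH].
  rewrite (_ : (fun x => \sum_(i < 0) f i x) = fun x => 0 * f 0%N x).
    by rewrite derive1nZ //; apply/funext => x; rewrite big_ord0 mul0r.
  by apply/funext => x; rewrite big_ord0 mul0r.
rewrite (_ : (fun x => \sum_(i < k.+1) f i x) =
             fun x => \sum_(i < k) f i x + f k x).
  rewrite derive1nD => [|i x _|i x _]; [|exact: smooth_sum|exact: sf].
  by rewrite IH; apply/funext => x; rewrite big_ord_recr.
by apply/funext => x; rewrite big_ord_recr.
Qed.

(** By Leibniz, (fg)' = f g' + g f' is a sum of products of smooth functions. The induction
    therefore runs over all pairs at once, and on a bound [N] for the order, because [derive1nD]
    needs every lower order. *)
Lemma smoothM (R : realType) (f g : R -> R) :
  smooth f -> smooth g -> smooth (fun x => f x * g x).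
Proof.
move=> sf sg j; move: {2}j (leqnn j) => N.
elim: N j f g sf sg => [|N IH] [|j] f g sf sg jN x //.
- by apply: (@derivableM _ _ f g); exact: smooth_derivable.
- by apply: (@derivableM _ _ f g); exact: smooth_derivable.
rewrite derive1Sn.
have -> : derive1 (fun x => f x * g x) =
    fun x => f x * derive1 g x + g x * derive1 f x.
  apply/funext => z; rewrite !derive1E (@deriveM _ _ f g) //;
  exact: smooth_derivable.
have sf' := smooth_derive1 _ _ sf; have sg' := smooth_derive1 _ _ sg.
have dfg i z : (i <= j)%N ->
    derivable (derive1n i (fun x => f x * derive1 g x)) z 1.
  by move=> ij; apply: IH => //; exact: leq_trans ij jN.
have dgf i z : (i <= j)%N ->
    derivable (derive1n i (fun x => g x * derive1 f x)) z 1.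
  by move=> ij; apply: IH => //; exact: leq_trans ij jN.
rewrite derive1nD; [|by move=> i z /ltnW; exact: dfg|by move=> i z /ltnW; exact: dgf].
by apply: (@derivableD _ _ _ (derive1n j _) (derive1n j _)); [exact: dfg|exact: dgf].
Qed.

Lemma derive1n_horner (R : realType) (p : {poly R}) (j : nat) :
  derive1n j (horner p) = horner (derivn j p).
Proof. by elim: j => // j IH; rewrite derive1nS IH -derivE derivnS. Qed.

Lemma smooth_horner (R : realType) (p : {poly R}) : smooth (horner p).
Proof. by move=> j x; rewrite derive1n_horner; exact: derivable_horner. Qed.

(** * Rescaling: each derivative of [dilate G e y] costs a factor 1/e *)

Lemma is_derive_dilate (R : realType) (G : R -> R) (e y x : R) :
  derivable G ((x - y) / e) 1 ->
  is_derive x (1 : R) (dilate G e y) (dilate (derive1 G) e y x / e).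
Proof.
move=> dG; rewrite /dilate derive1E.
apply: (@is_derive1_comp _ G (fun x => (x - y) / e)); first exact: DeriveDef.
rewrite (_ : (fun _ => _) = horner (e^-1 *: ('X - y%:P))).
  apply: is_derive_eq.
  by rewrite derivZ derivB derivX derivC subr0 hornerZ hornerC mulr1.
by apply/funext => z; rewrite !hornerE mulrC.
Qed.

Lemma derive1n_dilate (R : realType) (G : R -> R) (e y : R) (j : nat) :
  smooth G ->
  derive1n j (dilate G e y) = fun x => e^-1 ^+ j * dilate (derive1n j G) e y x.
Proof.
move=> sG; elim: j => [|j IH].
  by apply/funext => x; rewrite expr0 mul1r.
rewrite derive1nS IH; apply/funext => x.
have dx := @is_derive_dilate R (derive1n j G) e y x (sG j _).
rewrite derive1Ml; last exact: ex_derive.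
by rewrite derive1E derive_val exprSr -mulrA [_ / e]mulrC.
Qed.

Lemma smooth_dilate (R : realType) (G : R -> R) (e y : R) :
  smooth G -> smooth (dilate G e y).
Proof.
move=> sG j x; rewrite derive1n_dilate //.
have dx := @is_derive_dilate R (derive1n j G) e y x (sG j _).
exact: (@derivableZ _ _ _ (dilate (derive1n j G) e y)).
Qed.

(** * Derivatives and supports *)

Lemma derive1n_eq0_out_supp (R : realType) (f : R -> R) (j : nat) (x : R) :
  ~ supp f x -> derive1n j f x = 0.
Proof.
elim: j x => [|j IH] x nfx.
  by apply: contrapT => /eqP fx; apply: nfx; exact: subset_closure.
rewrite derive1nS derive1E.
(* The complement of the closed support is open, so the [j]-th derivative is zero near [x], not only
   at [x]. *)
rewrite (@near_eq_derive _ _ _ _ (cst 0)) ?derive_cst //.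
have := open_nbhs_nbhs (conj (closed_openC (@closed_closure _ [set x | f x != 0])) nfx).
by apply: filterS => z /IH.
Qed.

Lemma compact_supp_derive1n_bounded (R : realType) (f : R -> R) (j : nat) :
  smooth f -> compact (supp f) ->
  exists2 B : R, 0 <= B & forall x, `|derive1n j f x| <= B.
Proof.
move=> sf cf.
have : compact (derive1n j f @` supp f).
  apply: continuous_compact => //; apply: continuous_subspaceT.
  by apply: smooth_continuous; exact: smooth_derive1n.
move=> /compact_bounded[M [_ HM]].
(* Boundedness supplies every bound above [M]; this one is also nonnegative. *)
exists (`|M| + 1) => [|x]; first by rewrite addr_ge0.
have [fx|nfx] := pselect (supp f x).
  by apply: (HM (`|M| + 1)); [rewrite (le_lt_trans (ler_norm M)) // ltrDl|exists x].
by rewrite derive1n_eq0_out_supp // normr0 addr_ge0.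
Qed.

(** * Zeros accumulating at a point *)

Lemma limit_point_zeros (R : realType) (D : R -> R) (y : R) :
  continuous D -> limit_point [set x | D x = 0] y -> D y = 0.
Proof.
move=> cD /subset_limit_point; rewrite -(closure_id [set x | D x = 0]).1 //.
have -> : [set x | D x = 0] = D @^-1` [set 0] by [].
by apply: preimage_closed => // x _; exact: cD.
Qed.

(** By continuity [y] is itself a zero. Rolle between [y] and a nearby zero [z] gives a zero of the
    derivative strictly between them, hence different from [y] and no farther from it than [z]. *)
Lemma limit_point_zeros_derive1 (R : realType) (D : R -> R) (y : R) :
  smooth D -> limit_point [set x | D x = 0] y ->
  limit_point [set x | derive1 D x = 0] y.
Proof.
move=> sD ly; have Dy := limit_point_zeros _ _ _ (smooth_continuous _ _ sD) ly.
have rolle (a b : R) : a < b -> D a = D b ->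
    exists2 c, a < c < b & derive1 D c = 0.
  move=> ab Dab; have [|||c cab dc] := @Rolle R D a b ab.
  - by move=> x _; exact: smooth_derivable.
  - by apply: continuous_subspaceT; exact: smooth_continuous.
  - exact: Dab.
  by exists c; [move: cab; rewrite in_itv|rewrite derive1E derive_val].
move=> U /nbhs_ballP[r /= r0 rU].
have [z [zy /= Dz yz]] := ly _ (nbhsx_ballx y r r0).
move: yz; rewrite /ball/= => yz.
move: zy; rewrite neq_lt => /orP[zy|zy].
- have [|c /andP[zc cy] dc] := rolle z y zy; first by rewrite Dz Dy.
  exists c; split => //; first by rewrite lt_eqF.
  apply: rU; rewrite /ball/= gtr0_norm ?subr_gt0 //.
  by apply: le_lt_trans yz; rewrite gtr0_norm ?subr_gt0 // lerD2l lerN2 ltW.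
- have [|c /andP[yc cz] dc] := rolle y z zy; first by rewrite Dz Dy.
  exists c; split => //; first by rewrite gt_eqF.
  apply: rU; rewrite /ball/= distrC gtr0_norm ?subr_gt0 //.
  by apply: le_lt_trans yz; rewrite distrC gtr0_norm ?subr_gt0 // lerD2r ltW.
Qed.

Lemma derive1n_eq0_limit_point (R : realType) (D : R -> R) (y : R) (j : nat) :
  smooth D -> limit_point [set x | D x = 0] y -> derive1n j D y = 0.
Proof.
move=> sD ly; apply: limit_point_zeros.
  by apply: smooth_continuous; exact: smooth_derive1n.
elim: j => // j IH; rewrite derive1nS; apply: limit_point_zeros_derive1 => //.
exact: smooth_derive1n.
Qed.

(** Accumulation is local; this allows [K] to be cut down to the region where the cutoff is 1. *)
Lemma limit_pointI_nbhs (T : topologicalType) (A U : set T) (y : T) :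
  limit_point A y -> nbhs y U -> limit_point (A `&` U) y.
Proof.
move=> lA yU V yV; have [z [zy Az [Uz Vz]]] := lA _ (filterI yU yV).
by exists z.
Qed.

(** * Uniform bounds for polynomials of bounded degree and their cutoffs *)

(** A polynomial of degree at most [k] is recovered from its values at k+1 distinct nodes by
    inverting the Vandermonde matrix, which depends on [k] alone. *)
Lemma coef_bound (R : realType) (k : nat) :
  exists2 C : R, 0 <= C & forall (Q : {poly R}) (S : R), (size Q <= k.+1)%N ->
    (forall s, `|s| < 1 -> `|Q.[s]| <= S) -> forall i, `|Q`_i| <= C * S.
Proof.
(* The nodes i/(k+1) with i <= k are distinct and stay strictly below 1, where the bound on [Q] is
   available. *)
pose a : 'rV[R]_k.+1 := \row_(i < k.+1) (i%:R / k.+1%:R).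
pose V := Vandermonde k.+1 a.
have Vu : V \in unitmx.
  rewrite unitmxE det_Vandermonde unitfE; apply/prodf_neq0 => i _.
  apply/prodf_neq0 => j ij; rewrite !mxE -mulrBl mulf_neq0 // ?invr_eq0 //.
  by rewrite subr_eq0 eqr_nat gtn_eqF.
exists (\sum_i \sum_j `|(invmx V) i j|).
  by apply: sumr_ge0 => i _; apply: sumr_ge0.
move=> Q S sQ QS i.
have S0 : 0 <= S by apply: le_trans (QS 0 _); rewrite ?normr0.
have [ik|ik] := ltnP i k.+1; last first.
  rewrite nth_default ?normr0; last exact: leq_trans sQ ik.
  by rewrite mulr_ge0 //; apply: sumr_ge0 => l _; apply: sumr_ge0.
have QV : (\row_(l < k.+1) Q`_l) *m V = \row_(l < k.+1) Q.[a 0 l].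
  apply/rowP => l; rewrite !mxE (horner_coef_wide _ sQ).
  by apply: eq_bigr => h _; rewrite !mxE.
have /rowP/(_ (Ordinal ik)) : \row_(l < k.+1) Q`_l =
    (\row_(l < k.+1) Q.[a 0 l]) *m invmx V by rewrite -QV mulmxK.
rewrite !mxE /= => ->.
apply: le_trans (ler_norm_sum _ _ _) _; rewrite mulr_suml.
apply: ler_sum => l _; rewrite mxE normrM mulrC.
apply: ler_pM => //.
  by rewrite (bigD1 (Ordinal ik)) //= lerDl sumr_ge0.
apply: QS; rewrite mxE ger0_norm ?divr_ge0 //.
by rewrite ltr_pdivrMr // mul1r ltr_nat.
Qed.

(** Expanding [Q] in monomials reduces the bound to the finitely many functions [phi] times X^i, i
    <= k. These are smooth, compactly supported and independent of [Q]; [coef_bound] controls their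
    weights. *)
Lemma cutoff_derive1n_bound (R : realType) (phi : R -> R) (k j : nat) :
  smooth phi -> compact (supp phi) ->
  exists2 B : R, 0 <= B & forall (Q : {poly R}) (S : R), (size Q <= k.+1)%N ->
    (forall s, `|s| < 1 -> `|Q.[s]| <= S) ->
    forall x, `|derive1n j (fun s => phi s * Q.[s]) x| <= B * S.
Proof.
move=> sphi cphi; have [C C0 HC] := @coef_bound R k.
pose f i (s : R) := phi s * ('X^i).[s].
have sf i : smooth (f i) by apply: smoothM => //; exact: smooth_horner.
have cf i : compact (supp (f i)).
  apply: (subclosed_compact _ cphi); first exact: closed_closure.
  by apply: closure_subset => s /=; apply: contra => /eqP phi0; rewrite /f phi0 mul0r.
have /choice[B HB] i : exists B : R, 0 <= B /\ forall x, `|derive1n j (f i) x| <= B.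
  by have [B B0 HB] := compact_supp_derive1n_bounded _ _ j (sf i) (cf i); exists B.
exists (\sum_(i < k.+1) C * B i).
  by apply: sumr_ge0 => i _; rewrite mulr_ge0 // (HB i).1.
move=> Q S sQ QS x.
have -> : (fun s => phi s * Q.[s]) = fun s => \sum_(i < k.+1) Q`_i * f i s.
  apply/funext => s; rewrite (horner_coef_wide _ sQ) mulr_sumr.
  by apply: eq_bigr => i _; rewrite /f hornerXn mulrCA.
rewrite (derive1n_sum _ _ (fun i s => Q`_i * f i s)); last by move=> i; exact: smoothZ.
apply: le_trans (ler_norm_sum _ _ _) _; rewrite mulr_suml; apply: ler_sum => i _.
rewrite derive1nZ // normrM mulrAC; apply: ler_pM => //; first exact: HC.
exact: (HB i).2.
Qed.

(** The substitution x = e s + y reduces to width 1, and the derivative of order j then carries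
    e^-j. Leaving [r] free above [N] lets the caller take an exponent that is at least 1. *)
Lemma Cnorm_cutoff_bound (R : realType) (phi : R -> R) (k N : nat) :
  smooth phi -> compact (supp phi) ->
  exists2 C : R, 0 < C & forall (P : {poly R}), (size P <= k.+1)%N ->
    forall (e y : R) (r : nat), 0 < e -> (N <= r)%N ->
    (Cnorm N (fun x => dilate phi e y x * P.[x])%R
     <= (C / (Num.min e 1) ^+ r)%:E
        * sup_abs [set t : R | `|t - y| < e]%R (horner P))%E.
Proof.
move=> sphi cphi.
have /choice[B HB] j : exists B : R, 0 <= B /\
    forall (Q : {poly R}) (S : R), (size Q <= k.+1)%N ->
    (forall s, `|s| < 1 -> `|Q.[s]| <= S) ->
    forall x, `|derive1n j (fun s => phi s * Q.[s]) x| <= B * S.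
  by have [B B0 HB] := cutoff_derive1n_bound _ _ k j sphi cphi; exists B.
(* The sum dominates each [B j] with j <= N; the summand 1 makes the constant positive. *)
exists (1 + \sum_(j < N.+1) B j).
  by rewrite ltr_pwDl // sumr_ge0 // => j _; exact: (HB j).1.
set C := 1 + _ => P sP e y r e0 Nr.
have C0 : 0 < C.
  by rewrite ltr_pwDl // sumr_ge0 // => j _; exact: (HB j).1.
set mu := Num.min e 1.
have mu0 : 0 < mu by rewrite lt_min e0 ltr01.
have mu1 : mu <= 1 by rewrite ge_min lexx orbT.
have mue : mu <= e by rewrite ge_min lexx.
have Cmu0 : 0 < C / mu ^+ r by rewrite divr_gt0 // exprn_gt0.
set A := [set t : R | _].
have supP t : A t -> ((`|P.[t]|)%:E <= sup_abs A (horner P))%E.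
  by move=> At; apply: ereal_sup_ubound; exists t.
(* As an extended real, the supremum cannot be -oo because [y] lies in [A], and +oo makes the bound
   trivial. *)
case: (sup_abs A (horner P)) supP => [S supP|_|supP]; last first.
- by have := supP y; rewrite /A /= subrr normr0 => /(_ e0).
- by rewrite gt0_muley ?lte_fin // leey.
rewrite -EFinM; apply: ge_ereal_sup => _ [j /= jN [x _ <-]]; rewrite lee_fin.
(* [Q] is [P] in the rescaled variable: the affine substitution does not raise the degree and maps
   (-1,1) into [A]. *)
pose Q := P \Po (e *: 'X + y%:P).
have QE s : Q.[s] = P.[e * s + y] by rewrite horner_comp !hornerE.
have sQ : (size Q <= k.+1)%N.
  apply: leq_trans (size_comp_poly_leq _ _) _.
  have sl : ((size (e *: 'X + y%:P)%R).-1 <= 1)%N.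
    rewrite -subn1 leq_subLR; apply: leq_trans (size_polyD _ _) _.
    rewrite geq_max (leq_trans (size_scale_leq _ _)) ?size_polyX //=.
    by rewrite (leq_trans (size_polyC_leq1 _)).
  case: (size P) sP => [|p] //= pk.
  by apply: leq_trans pk; rewrite ltnS -[leqRHS]muln1 leq_mul2l sl orbT.
have QS s : `|s| < 1 -> `|Q.[s]| <= S.
  move=> s1; rewrite QE -lee_fin; apply: supP.
  by rewrite /A /= addrK normrM gtr0_norm // -ltr_pdivlMl // mulVf ?gt_eqF.
have S0 : 0 <= S by apply: le_trans (QS 0 _); rewrite ?normr0.
rewrite (_ : (fun _ => _) = dilate (fun s => phi s * Q.[s]) e y); last first.
  apply/funext => z; rewrite /dilate QE mulrCA divff ?gt_eqF // mulr1.
  by rewrite subrK.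
rewrite derive1n_dilate; last by apply: smoothM => //; exact: smooth_horner.
(* Here e^-j <= mu^-j <= mu^-r, from mu <= e, then mu <= 1 and j <= N <= r. *)
rewrite normrM mulrAC [leRHS]mulrC; apply: ler_pM => //.
  rewrite ger0_norm ?exprn_ge0 ?invr_ge0 ?(ltW e0) // -exprVn.
  apply: (@le_trans _ _ (mu^-1 ^+ j)).
    by apply: lerXn2r; rewrite ?nnegrE ?invr_ge0 ?(ltW e0) ?(ltW mu0) // lef_pV2 ?posrE.
  by apply: ler_weXn2l; [rewrite invf_ge1|exact: leq_trans Nr].
apply: le_trans ((HB j).2 _ _ sQ QS _) _; apply: ler_wpM2r => //.
rewrite /C (bigD1 (Ordinal (jN : (j < N.+1)%N))) //= addrCA lerDl.
by rewrite addr_ge0 // sumr_ge0 // => l _; exact: (HB l).1.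
Qed.

(** * Global norms and quotient norms *)

Lemma Cnorm_ge0 (R : realType) (n : nat) (F : R -> R) : (0 <= Cnorm n F)%E.
Proof.
apply: (@le_trans _ _ (`|F 0|)%:E); first by rewrite lee_fin.
by apply: ereal_sup_ubound; exists 0%N => //; exists 0.
Qed.

Lemma quotient_norm_ge0 (R : realType) (K : set R) (n : nat) (h : R -> R) :
  (0 <= quotient_norm K n h)%E.
Proof. by apply: le_ereal_inf_tmp => _ [F _ <-]; exact: Cnorm_ge0. Qed.

Lemma quotient_norm_le (R : realType) (K : set R) (n : nat) (F : R -> R) :
  smooth F -> (quotient_norm K n (F \_ K) <= Cnorm n F)%E.
Proof. by move=> sF; apply: ereal_inf_lbound; exists F. Qed.

(** Off the support every derivative is zero, hence at most its absolute value at a chosen point of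
    [A]. The point must exist: over an empty set the supremum would be -oo. *)
Lemma Cnorm_supp (R : realType) (n : nat) (A : set R) (f : R -> R) :
  A !=set0 -> supp f `<=` A -> (Cnorm n f <= sup_derivs n A f)%E.
Proof.
move=> [a Aa] fA; apply: ge_ereal_sup => _ [j /= jn [x _ <-]].
have [fx|nfx] := pselect (supp f x).
  by apply: ereal_sup_ubound; exists j => //; exists x => //; exact: fA.
rewrite derive1n_eq0_out_supp // normr0.
apply: (@le_trans _ _ (`|derive1n j f a|)%:E); first by rewrite lee_fin.
by apply: ereal_sup_ubound; exists j => //; exists a.
Qed.

(* Near an accumulation point the cutoff is 1, so every extension of the
   cut-off polynomial has there the derivatives of the polynomial. *)
Lemma quotient_norm_cutoff_ge (R : realType) (phi : R -> R) (K : set R)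
    (P : {poly R}) (e y : R) (f : R -> R) (m M : nat) :
  (forall x : R, - 2^-1 <= x <= 2^-1 -> phi x = 1) ->
  0 < e -> limit_point K y ->
  (forall x : R, K x -> f x = dilate phi e y x * P.[x]) -> (m <= M)%N ->
  ((`|(derivn m P).[y]|)%:E <= quotient_norm K M (f \_ K))%E.
Proof.
move=> phi1 e0 Ky fE mM; apply: le_ereal_inf_tmp => _ [F [sF FK] <-].
have sNP : smooth (fun x => -1 * P.[x]) by apply: smoothZ; exact: smooth_horner.
have sFP := smoothD _ _ _ sF sNP.
(* F - P vanishes on [K] near [y], so its zeros accumulate at [y] and all its derivatives vanish
   there. *)
have : derive1n m (fun x => F x + -1 * P.[x]) y = 0.
  apply: derive1n_eq0_limit_point => //.
  (* The radius e/2 keeps (z - y)/e in [-1/2, 1/2], where [phi] is 1. *)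
  have /(limit_pointI_nbhs _ _ _ _ Ky) : nbhs y (ball y (e / 2)).
    by apply: nbhsx_ballx; rewrite divr_gt0.
  move=> /[swap] U /[swap] yU /(_ _ yU)[z [zy [Kz yz] Uz]]; exists z; split => //=.
  have -> : F z = f z by have := congr1 (@^~ z) FK; rewrite !patchE mem_set.
  rewrite fE // /dilate phi1 ?mul1r ?mulN1r ?subrr //.
  rewrite -ler_norml normrM normfV (gtr0_norm e0) ler_pdivrMr // mulrC.
  by rewrite distrC ltW.
rewrite derive1nD => [|i x _|i x _]; [|exact: sF|exact: sNP].
rewrite derive1nZ; last exact: smooth_horner.
rewrite derive1n_horner mulN1r => /eqP; rewrite subr_eq0 => /eqP <-.
by apply: ereal_sup_ubound; exists m => //; exists y.
Qed.

(* The factor [Num.min e 1] is [e] for [e <= 1].  With [e] itself the bound is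
   false for large [e] (take K = [0, 1], n = 0, m = 1, y = 0, P = X). *)
Theorem proposition4p3 (R : realType) (phi : R -> R)
    (phi_smooth : smooth phi)
    (phi_compact : compact (supp phi))
    (phi_supp : supp phi `<=` [set x | -1 <= x <= 1])
    (phi_one : forall x : R, - 2^-1 <= x <= 2^-1 -> phi x = 1)
    (K : set R) (K_compact : compact K) (n : nat)
    (K_dominating : dominating_norm K n) :
  forall m : nat, exists r : nat, (1 <= r)%N /\
  forall k : nat, exists c : R, 0 < c /\
  forall (P : {poly R}), (size P <= k.+1)%N ->
  forall e : R, 0 < e ->
  forall y : R, limit_point K y ->
  forall f : R -> R, smooth f ->
    supp f `<=` [set x | y - e < x < y + e] ->
    (forall x : R, K x -> f x = dilate phi e y x * P.[x]) ->
    ((`|(derivn m P).[y]| ^+ 2)%:E <=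
       (c / (Num.min e 1) ^+ r)%:E
       * sup_abs [set t : R | `|t - y| < e]%R (horner P)
       * sup_derivs n [set t : R | `|t - y| < e]%R f)%E.
Proof.
move=> m; have [|N [c0 [_ c00 dom]]] := K_dominating (maxn m n).
  exact: leq_maxr.
(* [N] comes from domination at order [maxn m n], before [k] is introduced, so the exponent does not
   depend on the degree. *)
exists (maxn N 1); split; first exact: leq_maxr.
move=> k; have [C C0 HC] := Cnorm_cutoff_bound R phi k N phi_smooth phi_compact.
exists (c0 * C); split; first exact: mulr_gt0.
move=> P sP e e0 y Ky f sf suppf fE.
have fK : Cinfty_on K (f \_ K) by exists f.
pose g x := dilate phi e y x * P.[x].
have sg : smooth g.
  by apply: smoothM; [exact: smooth_dilate|exact: smooth_horner].
have gf : g \_ K = f \_ K.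
  by apply/funext => x; rewrite !patchE; case: ifPn => // /set_mem /fE.
have lower : ((`|(derivn m P).[y]|)%:E <= quotient_norm K (maxn m n) (f \_ K))%E.
  by apply: (quotient_norm_cutoff_ge _ phi _ _ e) => //; exact: leq_maxl.
have upperN : (quotient_norm K N (f \_ K) <= Cnorm N g)%E.
  by rewrite -gf; exact: quotient_norm_le.
have uppern : (quotient_norm K n (f \_ K)
    <= sup_derivs n [set t : R | `|t - y| < e]%R f)%E.
  apply: le_trans (quotient_norm_le _ _ _ _ sf) _; apply: Cnorm_supp.
    by exists y; rewrite /= subrr normr0.
  by move=> x /suppf /= xye; rewrite ltr_distl.
(* The lower bound is squared first, to match the product on the left of the domination
   inequality. *)
rewrite expr2 EFinM; apply: le_trans (lee_pmul _ _ lower lower) _ => //.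
apply: le_trans (dom _ fK) _; apply: lee_pmul uppern.
- by rewrite mule_ge0 ?lee_fin ?(ltW c00) // quotient_norm_ge0.
- exact: quotient_norm_ge0.
rewrite -[c0 * C / _]mulrA EFinM -muleA lee_pmul2l ?lte_fin //.
by apply: le_trans upperN _; apply: HC => //; exact: leq_maxl.
Qed.
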